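(* Considering an MEC network consisting of two priority classes of users (as described in the context), the optimal offloading frequencies of the end users (those of the Social Problem) are given by solving the equations $$g_k(x_k)=c_k^d\,D_{\mathrm i_k}^{\rm EC}(\mathbf x)+\sum_{j\in\mathcal H}\frac{\partial\, c_{\rm H}^d D_{\rm H}^{\rm EC}(\mathbf x)}{\partial x_k}\,x_j+\sum_{j\in\mathcal L}\frac{\partial\, c_{\rm L}^d D_{\rm L}^{\rm EC}(\mathbf x)}{\partial x_k}\,x_j,\qquad k=1,2,\dots,N,$$ where $\mathrm i_k=\mathrm H$ if $c_k^d=c_{\rm H}^d$ and $\mathrm i_k=\mathrm L$ if $c_k^d=c_{\rm L}^d$, and $$D_{\rm H}^{\rm EC}(\mathbf x)=\frac1{\Psi_{\rm H}},\qquad D_{\rm L}^{\rm EC}(\mathbf x)=\frac{\mu_B D_{\rm H}^{\rm EC}(\mathbf x)}{\Psi},\qquad \Psi_{\rm H}=\mu_B-\sum_{j:\,c_j^d=c_{\rm H}^d}\lambda_a x_j,\qquad \Psi=\mu_B-\sum_{j=1}^N\lambda_a x_j.$$ Solving these equations equals solving the equations $$g_k(x_k)=\begin{cases}c_k^d D_{\rm H}^{\rm EC}(\mathbf x)+\displaystyle\sum_{j\in\mathcal H}\frac{\lambda_a c_{\rm H}^d x_j}{\Psi_{\rm H}^2}+\sum_{j\in\mathcal L}\frac{\lambda_a\mu_B(\Psi_{\rm H}+\Psi)c_{\rm L}^d x_j}{\Psi^2\Psi_{\rm H}^2}, & \text{if } c_k^d=c_{\rm H}^d,\\[3mm] c_k^d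 D_{\rm L}^{\rm EC}(\mathbf x)+\displaystyle\sum_{j\in\mathcal L}\frac{\lambda_a\mu_B c_{\rm L}^d x_j}{\Psi^2\Psi_{\rm H}}, & \text{if } c_k^d=c_{\rm L}^d.\end{cases}$$
   Context: Users. There are $N=N_{\rm H}+N_{\rm L}$ end users and one access point (AP) with an edge server (a multi-access edge computing, MEC, system). $\mathcal H=\{1,\dots,N_{\rm H}\}$ and $\mathcal L=\{N_{\rm H}+1,\dots,N\}$. User $k$ has a delay weight $0<c_k^d<1$, equal to $c_{\rm H}^d$ for $k\in\mathcal H$ and to $c_{\rm L}^d$ for $k\in\mathcal L$, with $c_{\rm H}^d>c_{\rm L}^d$, and an energy weight $0<c_k^e<1$. Jobs arrive at each user as a Poisson process of rate $\lambda_a$. User $k$ offloads a job to the AP with probability (offloading frequency) $x_k$ and computes it locally with probability $\bar x_k=1-x_k$; $\mathbf x=(x_1,\dots,x_N)$. Utility. Local computing costs $Z_k^{\rm LC}(x_k)=c_k^eE_k^{\rm LC}+c_k^d/(\mu_m-\lambda_a\bar x_k)$, where $\mu_m$ is the local service rate and the local energy $E_k^{\rm LC}$ does not depend on $x_k$. Transmitting an offloaded job takes time $D_{k,1}^{\rm EC}(x_k)=l_a\mu_a/\beta_k(x_k)$ and energy $E_k^{\rm EC}(x_k)=P_{\rm tr}l_a\mu_a/\beta_k(x_k)$, where $l_a,\mu_a,P_{\rm tr}$ are constants ($\mu_a$ the average number of CPU cycles of a job, $l_a\mu_a$ the amount of data to transmit, $P_{\rm tr}$ the transmit power) and the rate threshold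 $\beta_k(x_k)$ is determined by $x_k=\Pr(|h_k|^2>(e^{\beta_k}-1)\rho_k^{-1})$, with $h_k$ the random small-scale channel gain and $\rho_k$ a constant (the ratio of path-loss-attenuated transmit power to noise power). The utility function is $$U_k(x_k)=Z_k^{\rm LC}(0)-\bar x_kZ_k^{\rm LC}(x_k)-x_k\bigl(c_k^eE_k^{\rm EC}(x_k)+c_k^dD_{k,1}^{\rm EC}(x_k)\bigr),$$ and the demand function is $g_k(x_k)=\partial U_k(x_k)/\partial x_k$; it is monotonically decreasing in $x_k$, and $g_k(x_k)=0$ has a unique solution. Edge queue. The AP runs an M/M/1 queue of service rate $\mu_B$ with two preemptive priority classes $\mathrm H$ (high) and $\mathrm L$ (low). If user $j$ is in class $\mathrm i_j\in\{\mathrm H,\mathrm L\}$, the expected times a job spends at the AP in the two classes are $$D_{\rm H}^{\rm EC}(\mathbf x)=\frac{1}{\mu_B-\sum_{j:\mathrm i_j=\mathrm H}\lambda_ax_j},\qquad D_{\rm L}^{\rm EC}(\mathbf x)=\frac{\mu_BD_{\rm H}^{\rm EC}(\mathbf x)}{\mu_B-\sum_{j:\mathrm i_j=\mathrm L}\lambda_ax_j-\sum_{j:\mathrm i_j=\mathrm H}\lambda_ax_j}.$$ (To minimize the total delay cost, users with $c_k^d=c_{\rm H}^d$ are to be given class $\mathrm H$ and the others class $\mathrm L$; this yields the expressions for $D_{\rm H}^{\rm EC}$ and $D_{\rm L}^{\rm EC}$ used in the claim.) Social Problem. User $k$'s profit is $V_k(\mathrm i_k,\mathbf x)=U_k(x_k)-c_k^dx_kD_{\mathrm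 i_k}^{\rm EC}(\mathbf x)$. The Social Problem is to maximize $\sum_jV_j(\mathrm i_j,\mathbf x)$ over all $\mathrm i_k\in\{\mathrm H,\mathrm L\}$ and $0\le x_k\le1$, $k=1,\dots,N$.
   Formalization: The equations characterize optima with 0 < x_k < 1 for all k and a stable edge queue (Ψ > 0); for a small service rate μ_B the optimum can have x_k = 0, where the equation fails, so such corner points are excluded. *)

(* Defs.v *)
From HB Require Import structures.
From mathcomp Require Import all_boot all_order all_algebra.
From mathcomp Require Import complex.
From mathcomp Require Import all_classical all_reals all_analysis.
Set Implicit Arguments.
Unset Strict Implicit.
Unset Printing Implicit Defensive.
Import Order.TTheory GRing.Theory Num.Theory.
Import numFieldNormedType.Exports.
Local Open Scope classical_set_scope.
Local Open Scope ring_scope.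

Variant priority := High | Low.

Definition is_high (c : priority) : bool := if c is High then true else false.

(* Users are indexed from 0: the first NH ones have the larger delay weight.  *)
Record mec (R : realType) (Omega : Type) (NH NL : nat) := Mec {
  lambda_a : R;                        (* job arrival rate of each user *)
  mu_m : R;                            (* local service rate *)
  mu_B : R;                            (* service rate of the edge server *)
  l_a : R;                             (* data per CPU cycle *)
  mu_a : R;                            (* average number of CPU cycles of a job *)
  P_tr : R;                            (* transmit power *)
  cdH : R;                             (* delay weight of the users in calH *)
  cdL : R;                             (* delay weight of the users in calL *)
  ce : 'I_(NH + NL) -> R;              (* energy weights *)
  E_LC : 'I_(NH + NL) -> R;            (* local computing energies *)
  rho : 'I_(NH + NL) -> R;             (* signal-to-noise constants *)
  h : 'I_(NH + NL) -> Omega -> R[i];   (* small-scale channel gains *)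
  beta : 'I_(NH + NL) -> R -> \bar R   (* rate thresholds *)
}.

Section Network.
Context {R : realType} {Omega : Type} {NH NL : nat} (S : mec R Omega NH NL).
Local Notation user := 'I_(NH + NL).
Local Notation freq := 'rV[R]_(NH + NL).
Implicit Types (k : user) (t : R) (x : freq) (i : user -> priority).

Definition calH : {set user} := [set k : user | (k < NH)%N]%SET.
Definition calL : {set user} := (~: calH)%SET.

Definition cd k : R := if k \in calH then cdH S else cdL S.

Definition gain k (w : Omega) : R := ComplexField.Normc.normc (h S k w) ^+ 2.

Definition Z_LC k t : R :=
  ce S k * E_LC S k + cd k / (mu_m S - lambda_a S * (1 - t)).

(* The inverse is the one of \bar R: the transmission time is +oo when the
   rate threshold is 0, and 0 when the rate threshold is +oo.                 *)
Definition D1_EC k t : \bar R := ((l_a S * mu_a S)%:E / beta S k t)%E.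

Definition E_EC k t : \bar R := ((P_tr S * (l_a S * mu_a S))%:E / beta S k t)%E.

Definition U k t : \bar R :=
  ((Z_LC k 0)%:E - ((1 - t) * Z_LC k t)%:E
   - t%:E * ((ce S k)%:E * E_EC k t + (cd k)%:E * D1_EC k t))%E.

(* U k is finite on the open interval ]0, 1[, where g is used. *)
Definition g k t : R := derive1 (fun s : R => fine (U k s)) t.

Definition load_in i x (c : bool) : R :=
  \sum_(j | is_high (i j) == c) lambda_a S * x ord0 j.

(* Expected times at the edge for an arbitrary assignment of the classes. The
   closed formulas are those of a stable queue; an unstable class has an
   infinite expected time, hence an infinite delay cost as soon as a user of
   that class has a positive offloading frequency.                            *)
Definition sojournH i x : \bar R :=
  if 0 < mu_B S - load_in i x true
  then ((mu_B S - load_in i x true)^-1)%:E else +oo%E.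

Definition sojournL i x : \bar R :=
  if 0 < mu_B S - load_in i x false - load_in i x true
  then (mu_B S * (mu_B S - load_in i x true)^-1
        / (mu_B S - load_in i x false - load_in i x true))%:E
  else +oo%E.

Definition V i x k : \bar R :=
  (U k (x ord0 k)
   - (cd k * x ord0 k)%:E * (if is_high (i k) then sojournH i x
                             else sojournL i x))%E.

Definition social_profit i x : \bar R := (\sum_k V i x k)%E.

Definition feasible x : Prop := forall k, 0 <= x ord0 k <= 1.

Definition social_optimum i x : Prop :=
  feasible x /\
  forall i' y, feasible y -> (social_profit i' y <= social_profit i x)%E.

Definition class_of k : priority := if cd k == cdH S then High else Low.

Definition Psi_H x : R := mu_B S - \sum_(j | cd j == cdH S) lambda_a S * x ord0 j.

Definition Psi x : R := mu_B S - \sum_j lambda_a S * x ord0 j.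

Definition D_H x : R := 1 / Psi_H x.

Definition D_L x : R := mu_B S * D_H x / Psi x.

Definition partial k (f : freq -> R) x : R := 'D_(delta_mx ord0 k) f x.

Definition marginal_equations x : Prop :=
  forall k,
    g k (x ord0 k) =
      cd k * (if is_high (class_of k) then D_H x else D_L x)
      + \sum_(j in calH) partial k (fun y => cdH S * D_H y) x * x ord0 j
      + \sum_(j in calL) partial k (fun y => cdL S * D_L y) x * x ord0 j.

Definition explicit_equations x : Prop :=
  forall k,
    (cd k = cdH S ->
     g k (x ord0 k) =
       cd k * D_H x
       + \sum_(j in calH) lambda_a S * cdH S * x ord0 j / Psi_H x ^+ 2
       + \sum_(j in calL)
           lambda_a S * mu_B S * (Psi_H x + Psi x) * cdL S * x ord0 j
           / (Psi x ^+ 2 * Psi_H x ^+ 2)) /\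
    (cd k = cdL S ->
     g k (x ord0 k) =
       cd k * D_L x
       + \sum_(j in calL)
           lambda_a S * mu_B S * cdL S * x ord0 j / (Psi x ^+ 2 * Psi_H x)).

End Network.

Record mec_assumptions (R : realType) (d : measure_display)
    (Omega : measurableType d) (P : probability Omega R) (NH NL : nat)
    (S : mec R Omega NH NL) : Prop := MecAssumptions {
  lambda_a_gt0 : 0 < lambda_a S;
  (* The local queue of a user that offloads nothing is stable, so that
     Z_LC k 0 is an expected cost.                                            *)
  local_stable : lambda_a S < mu_m S;
  mu_B_gt0 : 0 < mu_B S;
  l_a_gt0 : 0 < l_a S;
  mu_a_gt0 : 0 < mu_a S;
  P_tr_gt0 : 0 < P_tr S;
  cdL_gt0 : 0 < cdL S;
  cdL_lt_cdH : cdL S < cdH S;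
  cdH_lt1 : cdH S < 1;
  ce_bounds : forall k, 0 < ce S k < 1;
  rho_gt0 : forall k, 0 < rho S k;
  measurable_h_Re : forall k, measurable_fun setT (fun w => complex.Re (h S k w));
  measurable_h_Im : forall k, measurable_fun setT (fun w => complex.Im (h S k w));
  (* beta takes values in [0, +oo] so that the relation can hold at t = 0,
     where no finite threshold is suitable if the gain is unbounded.          *)
  beta_ge0 : forall k (t : R), 0 <= t <= 1 -> (0 <= beta S k t)%E;
  betaP : forall k (t : R), 0 <= t <= 1 ->
    t%:E = P [set w | ((expeR (beta S k t) - 1) * ((rho S k)^-1)%:E
                       < (gain S k w)%:E)%E];
  U_derivable : forall k (t : R), 0 < t < 1 ->
    derivable (fun s : R => fine (U S k s)) t 1;
  g_decreasing : forall k (s t : R), 0 < s -> s <= t -> t < 1 ->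
    g S k t <= g S k s;
  g_root : forall k, exists! t : R, 0 < t < 1 /\ g S k t = 0
}.

(* Main.v *)
(* Write T for the total load and A for the load of calH. Work conservation in
   the preemptive queue makes the total sojourn cost of all jobs independent of
   the classes, so only the sojourn of the jobs of calH matters, and it is
   smallest when they alone have priority. The delay cost is then
   (cdL * phi T + (cdH - cdL) * phi A) / lambda_a with phi u = u / (mu_B - u),
   which is convex in x. The utilities are concave because the demands decrease;
   at the end points of [0, 1] the tangent inequality survives because the rate
   thresholds decrease. Hence the first-order conditions are sufficient, and by
   Fermat's rule they are necessary. *)
Require Import Defs.
From mathcomp Require Import all_boot all_order all_algebra.
From mathcomp Require Import complex ring lra.
From mathcomp Require Import all_classical all_reals all_analysis.
From mathcomp Require Import measurable_realfun.
Import Order.TTheory GRing.Theory Num.Theory.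
Import numFieldNormedType.Exports.
Local Open Scope ring_scope.

(* Work conservation: the total sojourn cost does not depend on the classes. *)
Lemma conservation (R : fieldType) (m T s : R) : m - T != 0 -> m - s != 0 ->
  s * (m - s)^-1 + (T - s) * (m * (m - s)^-1 / (m - T)) = m / (m - T) - 1.
Proof. by move=> T0 s0; field; rewrite T0. Qed.

(** The gap is a square over a positive number. This is the only source of convexity in the delay
    cost. *)
Lemma inv_tangent (R : realFieldType) (u v : R) :
  0 < u -> 0 < v -> v^-1 - (u - v) / v ^+ 2 <= u^-1.
Proof.
move=> u0 v0; rewrite -subr_ge0.
rewrite (_ : _ - _ = (u - v) ^+ 2 / (u * v ^+ 2)); last by field; rewrite !gt_eqF.
by rewrite divr_ge0 ?sqr_ge0 // mulr_ge0 ?sqr_ge0 ?ltW.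
Qed.

(** The shape [a - b * (u - c)] is how [Psi] and [Psi_H] vary when one frequency moves from [c] to
    [u]. *)
Lemma is_derive_inv_affine (R : realType) (a b c s : R) : a - b * (s - c) != 0 ->
  is_derive s 1 (fun u : R => (a - b * (u - c))^-1) (b / (a - b * (s - c)) ^+ 2).
Proof.
move=> n0; have Da : is_derive s 1 (fun u : R => a - b * (u - c)) (- b).
  by apply: is_derive_eq; rewrite /GRing.scale /=; ring.
by apply: is_derive_eq; rewrite /GRing.scale /=; field.
Qed.

Section Network.
Context {R : realType} {d : measure_display} {Omega : measurableType d}
  {P : probability Omega R} {NH NL : nat} {S : mec R Omega NH NL}
  (hS : mec_assumptions P S).
Implicit Types (k : 'I_(NH + NL)) (t s : R) (x y : 'rV[R]_(NH + NL))
  (i : 'I_(NH + NL) -> priority) (Q : pred 'I_(NH + NL)).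

Lemma cd_gt0 k : 0 < cd S k.
Proof.
rewrite /cd; case: ifP => _; last exact: cdL_gt0 hS.
exact: lt_trans (cdL_gt0 hS) (cdL_lt_cdH hS).
Qed.

Lemma ce_gt0 k : 0 < ce S k.
Proof. by have /andP[] := ce_bounds hS k. Qed.

(** * Rate thresholds *)

Lemma measurable_gain k : measurable_fun setT (gain S k).
Proof.
have -> : gain S k =
    fun w => complex.Re (h S k w) ^+ 2 + complex.Im (h S k w) ^+ 2.
  apply/funext => w; rewrite /gain; case: (h S k w) => a b /=.
  by rewrite sqr_sqrtr // addr_ge0 // sqr_ge0.
apply: measurable_funD; apply: measurable_funX.
- exact: measurable_h_Re hS k.
- exact: measurable_h_Im hS k.
Qed.

(** No real gain exceeds an infinite bound, so at threshold [+oo] the event is empty and [betaP]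
    would give [t = 0]. *)
Lemma beta_fin k t : 0 < t <= 1 -> exists2 r, 0 <= r & beta S k t = r%:E.
Proof.
move=> /andP[t0 t1]; have t01 : 0 <= t <= 1 by rewrite ltW.
have := beta_ge0 hS k t01; have := betaP hS k t01.
case: (beta S k t) => [r _ r0|/= + _|//]; first by exists r.
rewrite (_ : [set _ | _]%classic = set0); last first.
  rewrite -subset0 => w /=.
  by rewrite gt0_mulye ?lte_fin ?invr_gt0 ?(rho_gt0 hS k).
by rewrite measure0 => -[] te; rewrite te ltxx in t0.
Qed.

(** If [beta S k t <= beta S k s], the event at [s] is contained in the event at [t], and [betaP]
    turns this into [s <= t]. *)
Lemma beta_decreasing {k t s} :
  0 < t -> t < s -> s <= 1 -> (beta S k s < beta S k t)%E.
Proof.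
move=> t0 ts s1.
have [r r0 er] := beta_fin k t ltac:(by rewrite t0 ltW ?(lt_le_trans ts)).
have [q q0 eq] := beta_fin k s ltac:(by rewrite (lt_trans t0)).
have Et := betaP hS k (t := t) ltac:(by rewrite ltW // ltW ?(lt_le_trans ts)).
have Es := betaP hS k (t := s) ltac:(by rewrite ltW // (lt_trans t0)).
rewrite ltNge; apply/negP => bts; suff : (s%:E <= t%:E)%E.
  by rewrite lee_fin leNgt ts.
have mset (u : R) : measurable
    [set w | (((expeR u%:E - 1) * ((rho S k)^-1)%:E
               < (gain S k w)%:E)%E)]%classic.
  rewrite /= -EFinB -EFinM.
  rewrite (_ : [set _ | _]%classic = setT `&`
    (gain S k) @^-1` `](expR u - 1) / rho S k, +oo[ )%classic.
    exact: measurable_gain.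
  by rewrite setTI; apply/seteqP; split => w /=; rewrite lte_fin in_itv /= andbT.
rewrite Es Et; apply: le_measure; rewrite ?inE ?er ?eq; [exact: mset..|].
move=> w /=; apply: le_lt_trans.
rewrite /= -!EFinB -!EFinM lee_fin ler_pM2r ?invr_gt0 ?(rho_gt0 hS k) //.
by rewrite lerD2r ler_expR -lee_fin -er -eq.
Qed.

(** * Utilities and their tangent bound *)

(* Expected cost, up to the factor 1 / beta, of transmitting an offloaded job. *)
Definition tr_cost k : R := (ce S k * P_tr S + cd S k) * (l_a S * mu_a S).

Lemma tr_cost_gt0 k : 0 < tr_cost k.
Proof.
by rewrite mulr_gt0 ?mulr_gt0 ?addr_gt0 ?mulr_gt0 ?ce_gt0 ?cd_gt0 ?(P_tr_gt0 hS)
  ?(l_a_gt0 hS) ?(mu_a_gt0 hS).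
Qed.

(* The utility with the transmission cost per offloaded job frozen at c. *)
Definition utility_at k c t : R := Z_LC S k 0 - (1 - t) * Z_LC S k t - t * c.

Lemma U_fin k t r : beta S k t = r%:E -> 0 < r ->
  U S k t = (utility_at k (tr_cost k / r) t)%:E.
Proof.
move=> br r0; rewrite /U /E_EC /D1_EC br inver gt_eqF //.
rewrite /= -!EFinD; congr (_ %:E).
by rewrite /utility_at /tr_cost; congr (_ - _ * _); field; rewrite gt_eqF.
Qed.

Lemma U_infty k t : beta S k t = 0%:E -> 0 < t -> U S k t = -oo%E.
Proof.
move=> br t0; rewrite /U /E_EC /D1_EC br inver eqxx.
by rewrite !gt0_muley ?lte_fin ?mulr_gt0 ?ce_gt0 ?cd_gt0 ?(P_tr_gt0 hS)
  ?(l_a_gt0 hS) ?(mu_a_gt0 hS) //= gt0_muley // lte_fin.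
Qed.

Lemma beta_interior k t : 0 < t < 1 -> exists2 r, 0 < r & beta S k t = r%:E.
Proof.
move=> /andP[t0 t1]; have [r r0 er] := beta_fin k t ltac:(by rewrite t0 ltW).
exists r => //; have := beta_decreasing (k := k) t0 t1 (lexx 1).
have [q q0 ->] := beta_fin k 1 ltac:(by rewrite ltr01 lexx).
by rewrite er lte_fin; apply: le_lt_trans.
Qed.

Lemma U_interior k t : 0 < t < 1 -> U S k t = (fine (U S k t))%:E.
Proof. by move=> /(beta_interior k)[r r0 er]; rewrite (U_fin k t r). Qed.

(** The convention [0 * y = 0] in [\bar R] erases the transmission cost, whatever the threshold at
    0. *)
Lemma U0 k : U S k 0 = 0%:E.
Proof. by rewrite /U mul0e sube0 subr0 mul1r -EFinB subrr. Qed.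

(** By the mean value theorem the slope of the chord is [g] at a point between [s] and [t];
    monotonicity compares it with [g S k t]. *)
Lemma U_tangent_interior k t s : 0 < t < 1 -> 0 < s < 1 ->
  fine (U S k s) <= fine (U S k t) + g S k t * (s - t).
Proof.
have D (u : R) : 0 < u < 1 -> is_derive u 1 (fun s => fine (U S k s)) (g S k u).
  by move=> /(U_derivable hS (k := k)) du; split => //; rewrite /g derive1E.
have M (a b : R) : 0 < a -> a < b -> b < 1 -> exists2 c, c \in `]a, b[ &
    fine (U S k b) - fine (U S k a) = g S k c * (b - a).
  move=> a0 ab b1; apply: (MVT (f := fun s => fine (U S k s)) (df := g S k) ab)
      => [u|].
    rewrite in_itv /= => /andP[au ub]; apply: D.
    by rewrite (lt_trans a0) // (lt_trans ub).
  apply: derivable_within_continuous => u.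
  rewrite in_itv /= => /andP[au ub]; apply: (U_derivable hS).
  by rewrite (lt_le_trans a0) // (le_lt_trans ub).
move=> /andP[t0 t1] /andP[s0 s1].
case: (ltgtP s t) => [st|ts|->]; last by rewrite subrr mulr0 addr0.
- have [c + e] := M _ _ s0 st t1; rewrite in_itv /= => /andP[sc ct].
  have gc := g_decreasing hS k (lt_trans s0 sc) (ltW ct) t1.
  have : g S k t * (t - s) <= g S k c * (t - s).
    by apply: ler_wpM2r => //; rewrite subr_ge0 ltW.
  by rewrite -e; lra.
- have [c + e] := M _ _ t0 ts s1; rewrite in_itv /= => /andP[tc cs].
  have gc := g_decreasing hS k t0 (ltW tc) (lt_trans cs s1).
  have : g S k c * (s - t) <= g S k t * (s - t).
    by apply: ler_wpM2r => //; rewrite subr_ge0 ltW.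
  by rewrite -e; lra.
Qed.

(** With the transmission cost frozen, continuity at the end points involves only the local queue,
    not [beta]. *)
Lemma utility_at_continuous k c s :
  0 <= s <= 1 -> {for s, continuous (utility_at k c)}.
Proof.
move=> /andP[s0 s1]; apply/differentiable_continuous/derivable1_diffP.
have P0 : mu_m S - lambda_a S * (1 - s) != 0.
  rewrite gt_eqF // subr_gt0 (le_lt_trans _ (local_stable hS)) //.
  by rewrite ler_piMr ?(ltW (lambda_a_gt0 hS)) // lerBlDr lerDl.
rewrite /utility_at /Z_LC; apply: derivableB => //; apply: derivableB => //.
Qed.

Lemma U_tangent k t s : 0 < t < 1 -> 0 <= s <= 1 ->
  (U S k s <= (fine (U S k t) + g S k t * (s - t))%:E)%E.
Proof.
move=> t01 /andP[]; have /andP[t0 t1] := t01.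
set L := fun u => fine (U S k t) + g S k t * (u - t).
have cL (u : R) : {for u, continuous L}.
  by apply/differentiable_continuous/derivable1_diffP; rewrite /L.
rewrite le_eqVlt => /predU1P[<- _|s0]; last rewrite le_eqVlt => /predU1P[->|s1].
(* Near 0 the thresholds exceed the one at [t], so the utility with cost frozen at [tr_cost k / r]
   lies below [U], hence below the tangent; its value at 0 is [U S k 0]. *)
- have [r r0 er] := beta_interior k _ t01.
  rewrite U0 lee_fin -/(L 0).
  have U00 : utility_at k (tr_cost k / r) 0 = 0.
    by rewrite /utility_at subr0 mul1r subrr mul0r subr0.
  have cU := @utility_at_continuous k (tr_cost k / r) 0
    ltac:(by rewrite lexx ler01).
  rewrite -[leLHS]U00; apply: (@ler_cvg_to R (at_right 0) _ R _ _ _ _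
    (cvg_at_right_filter cU) (cvg_at_right_filter (cL 0))).
  near=> u; have u0 : 0 < u by [].
  have ut : u < t by near: u; exact: nbhs_right_lt.
  have u01 : 0 < u < 1 by rewrite u0 (lt_trans ut).
  apply: le_trans (U_tangent_interior k _ _ t01 u01).
  have [q q0 eq] := beta_interior k _ u01.
  rewrite (U_fin k u q) // /utility_at lerB // ler_wpM2l ?(ltW u0) //
    ler_wpM2l ?(ltW (tr_cost_gt0 k)) //.
  by rewrite lef_pV2 // -lee_fin -er -eq ltW // beta_decreasing ?(ltW t1).
(* Here the cost is frozen at the threshold of 1, smaller than those at interior points; if it is 0,
   the utility at 1 is [-oo]. *)
- have [r r0 er] := beta_fin k 1 ltac:(by rewrite ltr01 lexx).
  move: r0; rewrite le_eqVlt => /predU1P[r0|r0].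
    by rewrite U_infty ?leNye // er r0.
  rewrite (U_fin k 1 r) // lee_fin -/(L 1).
  have cU := @utility_at_continuous k (tr_cost k / r) 1
    ltac:(by rewrite lexx ler01).
  apply: (@ler_cvg_to R (at_left 1) _ R _ _ _ _
    (cvg_at_left_filter cU) (cvg_at_left_filter (cL 1))).
  near=> u; have u1 : u < 1 by [].
  have tu : t < u by near: u; exact: nbhs_left_gt.
  have u0 := lt_trans t0 tu.
  have u01 : 0 < u < 1 by rewrite u0.
  apply: le_trans (U_tangent_interior k _ _ t01 u01).
  have [q q0 eq] := beta_interior k _ u01.
  rewrite (U_fin k u q) // /utility_at lerB // ler_wpM2l ?(ltW u0) //
    ler_wpM2l ?(ltW (tr_cost_gt0 k)) //.
  by rewrite lef_pV2 // -lee_fin -er -eq ltW // beta_decreasing.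
- have s01 : 0 < s < 1 by rewrite s0.
  by rewrite U_interior // lee_fin U_tangent_interior.
Unshelve. all: by end_near.
Qed.

(** * Loads and stability *)

Local Notation inH := (fun k => k \in calH).

Definition load Q y : R := \sum_(j | Q j) lambda_a S * y ord0 j.

Lemma cd_high k : (cd S k == cdH S) = (k \in calH).
Proof.
rewrite /cd; case: ifP => _; first exact: eqxx.
by rewrite lt_eqF ?(cdL_lt_cdH hS).
Qed.

(** All jobs pay [cdL S] and those of [calH] pay the surplus; this splits a delay cost into a term
    over all users and a term over [calH]. *)
Lemma cdE k : cd S k = cdL S + (k \in calH)%:R * (cdH S - cdL S).
Proof. by rewrite /cd; case: ifP => _ /=; ring. Qed.

Lemma is_high_class_of k : is_high (class_of S k) = (k \in calH).
Proof. by rewrite /class_of cd_high; case: ifP. Qed.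

Lemma Psi_HE y : Psi_H S y = mu_B S - load inH y.
Proof. by rewrite /Psi_H (eq_bigl _ _ cd_high). Qed.

Lemma load_ge0 Q y : feasible y -> 0 <= load Q y.
Proof.
move=> fy; apply: sumr_ge0 => j _; have /andP[y0 _] := fy j.
by rewrite mulr_ge0 // (ltW (lambda_a_gt0 hS)).
Qed.

Lemma load_split Q Q' y :
  load Q y = load (fun j => Q j && Q' j) y + load (fun j => Q j && ~~ Q' j) y.
Proof. by rewrite /load (bigID Q'). Qed.

Lemma load_le Q y : feasible y -> load Q y <= load predT y.
Proof.
move=> fy; rewrite (load_split predT Q).
by rewrite (_ : load Q y = load (fun j => predT j && Q j) y) // lerDl load_ge0.
Qed.

Lemma Psi_le_Psi_H y : feasible y -> Psi S y <= Psi_H S y.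
Proof. by move=> fy; rewrite Psi_HE lerB // load_le. Qed.

Lemma load_in_true i y : load_in S i y true = load (is_high \o i) y.
Proof. by apply: eq_bigl => j; rewrite eqb_id. Qed.

Lemma load_inD i y : load_in S i y false + load_in S i y true = load predT y.
Proof.
rewrite addrC load_in_true (load_split predT (is_high \o i)); congr (_ + _).
by apply: eq_bigl => j; rewrite eqbF_neg.
Qed.

Lemma PsiE i y : mu_B S - load_in S i y false - load_in S i y true = Psi S y.
Proof. by rewrite -addrA -opprD load_inD. Qed.

(** Real-valued version of [sojournH] and [sojournL] for the stable case. [Psi S y] can stand in the
    low class because the total load is the same for all assignments. *)
Definition sojourn i y (c : bool) : R :=
  if c then (mu_B S - load_in S i y true)^-1
  else mu_B S * (mu_B S - load_in S i y true)^-1 / Psi S y.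

Definition delay_cost i y : R :=
  \sum_k cd S k * y ord0 k * sojourn i y (is_high (i k)).

(* u / (mu_B - u) = mu_B / (mu_B - u) - 1, here with mu_B - u = Psi, Psi_H. *)
Definition opt_cost y : R :=
  (cdL S * (mu_B S / Psi S y - 1)
   + (cdH S - cdL S) * (mu_B S / Psi_H S y - 1)) / lambda_a S.

Lemma V_stable i y k : feasible y -> 0 < Psi S y ->
  V S i y k =
  (U S k (y ord0 k) - (cd S k * y ord0 k * sojourn i y (is_high (i k)))%:E)%E.
Proof.
move=> fy Py.
have Ht : 0 < mu_B S - load_in S i y true.
  apply: lt_le_trans Py _; rewrite lerB // load_in_true; exact: load_le.
rewrite /V /sojourn /sojournH /sojournL PsiE Ht Py.
by case: ifP => _.
Qed.

(** The total load is at least [mu_B S], hence positive. Either it is all in the high class, which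
    is then unstable, or some user of the low class offloads and waits forever. *)
Lemma social_profit_unstable i y : feasible y -> Psi S y <= 0 ->
  social_profit S i y = -oo%E.
Proof.
move=> fy Py.
have pos Q : load Q y != 0 -> exists2 k, Q k & 0 < y ord0 k.
  move=> /eqP; rewrite /load => /psumr_neq0P[j _|k /andP[Qk]].
    by have /andP[y0 _] := fy j; rewrite mulr_ge0 // (ltW (lambda_a_gt0 hS)).
  by rewrite pmulr_rgt0 ?(lambda_a_gt0 hS) //; exists k.
have Vy k : 0 < y ord0 k ->
    (if is_high (i k) then sojournH S i y else sojournL S i y) = +oo%E ->
    V S i y k = -oo%E.
  move=> yk; rewrite /V => ->.
  by rewrite gt0_muley ?addeNy // lte_fin mulr_gt0 // cd_gt0.
(* In [\bar R] a single summand [-oo] absorbs all the others, even [+oo]. *)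
apply/esum_eqNyP; have [l0|] := eqVneq (load_in S i y false) 0.
- have lt : load_in S i y true = load predT y by rewrite -(load_inD i) l0 add0r.
  have [k hk yk] : exists2 k, is_high (i k) & 0 < y ord0 k.
    apply: (pos (is_high \o i)); rewrite -load_in_true lt gt_eqF //.
    by rewrite (lt_le_trans (mu_B_gt0 hS)) // -subr_le0.
  exists k; split; rewrite ?mem_index_enum //; apply: Vy => //.
  by rewrite hk /sojournH lt ltNge Py.
- rewrite (_ : load_in _ _ _ _ = load (predC (is_high \o i)) y); last first.
    by apply: eq_bigl => j; rewrite eqbF_neg.
  move=> /pos[k /negbTE hk yk].
  exists k; split; rewrite ?mem_index_enum //; apply: Vy => //.
  by rewrite -[is_high _]/((is_high \o i) k) hk /sojournL PsiE ltNge Py.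
Qed.

(** * Delay costs of arbitrary and of optimal classes *)

Lemma sum_sojourn i y Q :
  \sum_(k | Q k) lambda_a S * y ord0 k * sojourn i y (is_high (i k)) =
  load (fun k => Q k && is_high (i k)) y * sojourn i y true
  + load (fun k => Q k && ~~ is_high (i k)) y * sojourn i y false.
Proof.
rewrite (bigID (is_high \o i)) /= /load !big_distrl /=.
by congr (_ + _); apply: eq_bigr => k /andP[_]; [move=> -> | move=> /negbTE ->].
Qed.

Lemma delay_costE i y : lambda_a S * delay_cost i y =
  cdL S * (\sum_k lambda_a S * y ord0 k * sojourn i y (is_high (i k)))
  + (cdH S - cdL S) *
    \sum_(k in calH) lambda_a S * y ord0 k * sojourn i y (is_high (i k)).
Proof.
rewrite !big_distrr /= [X in _ + X]big_mkcond -big_split /=.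
by apply: eq_bigr => k _; rewrite cdE; case: ifP => _ /=; ring.
Qed.

(** Instance of [conservation] with [T] the total load and [s] the load of the high class. *)
Lemma sum_sojourn_all i y : feasible y -> 0 < Psi S y ->
  \sum_k lambda_a S * y ord0 k * sojourn i y (is_high (i k)) =
  mu_B S / Psi S y - 1.
Proof.
move=> fy Py; rewrite (sum_sojourn i y predT).
have Ht : 0 < mu_B S - load_in S i y true.
  apply: lt_le_trans Py _; rewrite lerB // load_in_true; exact: load_le.
rewrite -(conservation _ _ (load predT y) (load_in S i y true)) ?gt_eqF //.
congr (_ * _ + _ * _); first by rewrite load_in_true.
by rewrite (load_split predT (is_high \o i)) load_in_true [X in X - _]addrC addrK.
Qed.

Lemma delay_cost_class_of y : feasible y -> 0 < Psi S y ->
  delay_cost (class_of S) y = opt_cost y.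
Proof.
move=> fy Py; have l0 := lambda_a_gt0 hS.
apply: (mulfI (lt0r_neq0 l0)); rewrite delay_costE sum_sojourn_all //.
rewrite [RHS]mulrC divfK ?gt_eqF //; congr (_ + _ * _).
rewrite sum_sojourn /sojourn load_in_true.
have -> : load (fun k => inH k && ~~ is_high (class_of S k)) y = 0.
  by rewrite /load big1 // => k /andP[/= kH]; rewrite is_high_class_of kH.
have -> : load (fun k => inH k && is_high (class_of S k)) y = load inH y.
  by apply: eq_bigl => k /=; rewrite is_high_class_of andbb.
have -> : load (is_high \o class_of S) y = load inH y.
  by apply: eq_bigl => k /=; rewrite is_high_class_of.
have PH := lt_le_trans Py (Psi_le_Psi_H _ fy).
rewrite mul0r addr0 -Psi_HE -[X in X / _](subKr (mu_B S)) -Psi_HE.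
by field; rewrite gt_eqF.
Qed.

(** By [sum_sojourn_all] only the surplus term depends on [i]. By [conservation], its value in
    [opt_cost] is the sojourn cost of [calH] alone in the queue with the classes [i]; adding [calL]
    can only lengthen these sojourns. *)
Lemma delay_cost_ge i y : feasible y -> 0 < Psi S y ->
  opt_cost y <= delay_cost i y.
Proof.
move=> fy Py; have l0 := lambda_a_gt0 hS.
rewrite ler_pdivrMr // [leRHS]mulrC delay_costE sum_sojourn_all // lerD2l.
rewrite ler_pM2l ?subr_gt0 ?(cdL_lt_cdH hS) // sum_sojourn /sojourn load_in_true.
set a := load (fun k => inH k && is_high (i k)) y.
set c := load (fun k => inH k && ~~ is_high (i k)) y.
set s := load (is_high \o i) y.
have PH := lt_le_trans Py (Psi_le_Psi_H _ fy).
have Ps : 0 < mu_B S - s by apply: lt_le_trans Py _; rewrite lerB // load_le.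
have aP : mu_B S - s <= mu_B S - a.
  have -> : a = load (fun k => (is_high \o i) k && inH k) y.
    by apply: eq_bigl => k /=; rewrite andbC.
  by rewrite lerB // /s [leRHS](load_split _ inH) lerDl load_ge0.
have a0 : 0 <= a by exact: load_ge0.
have c0 : 0 <= c by exact: load_ge0.
have E : Psi_H S y = mu_B S - (a + c).
  by rewrite Psi_HE (load_split _ (is_high \o i)).
have Pa := lt_le_trans Ps aP.
rewrite E in PH *; rewrite -(conservation _ _ _ a) ?gt_eqF // [a + c]addrC addrK.
have m0 := mu_B_gt0 hS.
have inva : (mu_B S - a)^-1 <= (mu_B S - s)^-1 by rewrite lef_pV2.
rewrite lerD // ler_wpM2l // ler_pM ?mulr_ge0 ?invr_ge0
  ?(ltW PH) ?(ltW Pa) ?(ltW m0) //.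
- by rewrite addrC ltW.
- by rewrite ler_wpM2l // ltW.
- by rewrite lef_pV2 // 1?[c + a]addrC // -E Psi_le_Psi_H.
Qed.

Lemma social_profit_interior i y : (forall k, 0 < y ord0 k < 1) ->
  0 < Psi S y ->
  social_profit S i y =
  (\sum_k fine (U S k (y ord0 k)) - delay_cost i y)%:E.
Proof.
move=> yi Py.
have fy : feasible y by move=> k; have /andP[/ltW -> /ltW ->] := yi k.
rewrite /social_profit -sumrB -sumEFin; apply: eq_bigr => k _.
by rewrite V_stable // (U_interior) // EFinB.
Qed.

(** A finite profit is always attainable, so no optimum has profit [-oo], and optima are stable. *)
Lemma social_profit0 i : social_profit S i 0 = 0%:E.
Proof.
have f0 : feasible (0 : 'rV[R]_(NH + NL)).
    by move=> k; rewrite mxE lexx ler01.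
have P0 : 0 < Psi S 0.
  rewrite /Psi big1 ?subr0 ?(mu_B_gt0 hS) // => k _; by rewrite mxE mulr0.
rewrite /social_profit big1 // => k _.
by rewrite V_stable // mxE U0 mulr0 mul0r sube0.
Qed.

(** * Convexity and derivatives of the optimal delay cost *)

Definition opt_cost_grad k y : R :=
  cdL S * mu_B S / Psi S y ^+ 2
  + (k \in calH)%:R * (cdH S - cdL S) * mu_B S / Psi_H S y ^+ 2.

Lemma loadB Q x y :
  load Q x - load Q y = \sum_(k | Q k) lambda_a S * (x ord0 k - y ord0 k).
Proof. by rewrite -sumrB; apply: eq_bigr => k _; rewrite mulrBr. Qed.

(** [inv_tangent] applies to [Psi] and [Psi_H], both affine in the frequencies, with weights [cdL S]
    and [cdH S - cdL S]. *)
Lemma opt_cost_tangent x y : 0 < Psi S x -> 0 < Psi S y ->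
  0 < Psi_H S x -> 0 < Psi_H S y ->
  opt_cost x + \sum_k opt_cost_grad k x * (y ord0 k - x ord0 k) <= opt_cost y.
Proof.
move=> Px Py Hx Hy; have l0 := lambda_a_gt0 hS; have m0 := mu_B_gt0 hS.
have E : lambda_a S * \sum_k opt_cost_grad k x * (y ord0 k - x ord0 k) =
   cdL S * (mu_B S * (- ((Psi S y - Psi S x) / Psi S x ^+ 2)))
   + (cdH S - cdL S) * (mu_B S * (- ((Psi_H S y - Psi_H S x) / Psi_H S x ^+ 2))).
  have -> : Psi S y - Psi S x = - (load predT y - load predT x).
    by rewrite /Psi -/(load predT y) -/(load predT x); ring.
  have -> : Psi_H S y - Psi_H S x = - (load inH y - load inH x).
    by rewrite !Psi_HE; ring.
  rewrite !loadB [X in _ + _ * (_ * - (- X / _))]big_mkcond /=.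
  rewrite !mulNr !opprK !big_distrl /= !big_distrr /= -big_split /=.
  apply: eq_bigr => k _; rewrite /opt_cost_grad.
  by case: ifP => _ /=; ring.
rewrite -(ler_pM2l l0) mulrDr E /opt_cost !(mulrC (lambda_a S)) !divfK ?gt_eqF //.
have c0 := cdL_gt0 hS; have c1 : 0 <= cdH S - cdL S.
  by rewrite subr_ge0 ltW ?(cdL_lt_cdH hS).
rewrite addrACA -!mulrDr lerD // ler_wpM2l ?(ltW c0) //.
- rewrite addrAC lerB // -mulrDr ler_wpM2l ?(ltW m0) //; exact: inv_tangent.
- rewrite addrAC lerB // -mulrDr ler_wpM2l ?(ltW m0) //; exact: inv_tangent.
Qed.

(** Written as [c *: delta_mx ord0 k + x] to match the points in the difference quotients of
    [partial]. *)
Definition set_freq x k (s : R) : 'rV[R]_(NH + NL) :=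
  (s - x ord0 k) *: delta_mx ord0 k + x.

Lemma set_freqE x k s j : set_freq x k s ord0 j = if j == k then s else x ord0 j.
Proof. by rewrite !mxE /=; case: eqP => [->|_] /=; ring. Qed.

Lemma set_freq_id x k : set_freq x k (x ord0 k) = x.
Proof. by rewrite /set_freq subrr scale0r add0r. Qed.

Lemma load_set_freq Q x k s :
  load Q (set_freq x k s) = load Q x + (Q k)%:R * (lambda_a S * (s - x ord0 k)).
Proof.
apply/eqP; rewrite addrC -subr_eq loadB.
apply/eqP; rewrite big_mkcond (bigD1 k) //=.
rewrite big1 ?addr0 ?set_freqE ?eqxx => [|j /negbTE jk].
  by case: (Q k); rewrite ?mul1r ?mul0r.
by rewrite set_freqE jk subrr mulr0 if_same.
Qed.

Lemma Psi_set_freq x k s :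
  Psi S (set_freq x k s) = Psi S x - lambda_a S * (s - x ord0 k).
Proof.
rewrite /Psi -/(load predT (set_freq x k s)) load_set_freq -/(load predT x) mul1r.
by rewrite opprD addrA.
Qed.

Lemma Psi_H_set_freq x k s : Psi_H S (set_freq x k s) =
  Psi_H S x - (k \in calH)%:R * (lambda_a S * (s - x ord0 k)).
Proof. by rewrite !Psi_HE load_set_freq opprD addrA. Qed.

Lemma is_derive_inv_Psi x k s : Psi S (set_freq x k s) != 0 ->
  is_derive s 1 (fun u => (Psi S (set_freq x k u))^-1)
    (lambda_a S / Psi S (set_freq x k s) ^+ 2).
Proof.
rewrite Psi_set_freq => /is_derive_inv_affine.
by under [X in is_derive _ _ X _]eq_fun do rewrite -Psi_set_freq.
Qed.

Lemma is_derive_inv_Psi_H x k s : Psi_H S (set_freq x k s) != 0 ->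
  is_derive s 1 (fun u => (Psi_H S (set_freq x k u))^-1)
    ((k \in calH)%:R * lambda_a S / Psi_H S (set_freq x k s) ^+ 2).
Proof.
rewrite Psi_H_set_freq mulrA => /is_derive_inv_affine.
by under [X in is_derive _ _ X _]eq_fun do rewrite -mulrA -Psi_H_set_freq.
Qed.

Lemma is_derive_opt_cost x k s :
  Psi S (set_freq x k s) != 0 -> Psi_H S (set_freq x k s) != 0 ->
  is_derive s 1 (fun u => opt_cost (set_freq x k u))
    (opt_cost_grad k (set_freq x k s)).
Proof.
move=> nP nH; have DP := is_derive_inv_Psi _ _ _ nP.
have DH := is_derive_inv_Psi_H _ _ _ nH.
rewrite /opt_cost; apply: is_derive_eq.
rewrite /opt_cost_grad /GRing.scale /=; field.
by rewrite nP nH gt_eqF ?(lambda_a_gt0 hS).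
Qed.

Lemma partialE k (f : 'rV[R]_(NH + NL) -> R) x df :
  is_derive (x ord0 k) 1 (fun s : R => f (set_freq x k s)) df ->
  partial k f x = df.
Proof.
move=> [_ <-]; rewrite /partial /derive.
rewrite (_ : (fun h => h^-1 *: ((f \o shift x) _ - _)) =
  (fun h => h^-1 *: (((fun s => f (set_freq x k s)) \o shift (x ord0 k)) (h *: 1)
                     - f (set_freq x k (x ord0 k))))) //.
by apply/funext => t /=; rewrite set_freq_id /set_freq /= /GRing.scale /= mulr1 addrK.
Qed.

(** Together with [sum_calL], this eliminates the frequencies, so that both systems become rational
    identities in [Psi] and [Psi_H]. *)
Lemma sum_calH x (c : R) :
  \sum_(j in calH) c * x ord0 j = c * ((mu_B S - Psi_H S x) / lambda_a S).
Proof.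
rewrite Psi_HE subKr /load -!big_distrr /=; congr (_ * _).
rewrite [RHS]mulrC mulKf //.
by rewrite gt_eqF ?(lambda_a_gt0 hS).
Qed.

Lemma sum_calL x (c : R) :
  \sum_(j in calL) c * x ord0 j = c * ((Psi_H S x - Psi S x) / lambda_a S).
Proof.
have -> : Psi_H S x - Psi S x = load (fun j => j \in calL) x.
  have E : load predT x = load inH x + load (fun j => j \in calL) x.
    rewrite (load_split predT inH); congr (_ + _).
    by apply: eq_bigl => j; rewrite /calL finset.in_setC.
  by rewrite Psi_HE /Psi -/(load predT x) E; ring.
rewrite /load -!big_distrr /=; congr (_ * _).
rewrite [RHS]mulrC mulKf //.
by rewrite gt_eqF ?(lambda_a_gt0 hS).
Qed.

(** * Both systems of equations as a gradient condition *)

Lemma partial_D_H x k : 0 < Psi_H S x ->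
  partial k (fun y => cdH S * D_H S y) x =
  (k \in calH)%:R * lambda_a S * cdH S / Psi_H S x ^+ 2.
Proof.
move=> Hx; apply: partialE.
have nH : Psi_H S (set_freq x k (x ord0 k)) != 0 by rewrite set_freq_id gt_eqF.
have DH := is_derive_inv_Psi_H _ _ _ nH.
rewrite /D_H; apply: is_derive_eq.
by rewrite /GRing.scale /= set_freq_id; field; rewrite gt_eqF.
Qed.

(** [Psi] depends on every frequency, [Psi_H] only on those of [calH]; the indicator separates the
    two cases of the explicit equations. *)
Lemma partial_D_L x k : 0 < Psi S x -> 0 < Psi_H S x ->
  partial k (fun y => cdL S * D_L S y) x =
  lambda_a S * mu_B S * cdL S *
    (Psi_H S x + (k \in calH)%:R * Psi S x) / (Psi S x ^+ 2 * Psi_H S x ^+ 2).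
Proof.
move=> Px Hx; apply: partialE.
have nP : Psi S (set_freq x k (x ord0 k)) != 0 by rewrite set_freq_id gt_eqF.
have nH : Psi_H S (set_freq x k (x ord0 k)) != 0 by rewrite set_freq_id gt_eqF.
have DP := is_derive_inv_Psi _ _ _ nP; have DH := is_derive_inv_Psi_H _ _ _ nH.
rewrite /D_L /D_H; apply: is_derive_eq.
by rewrite /GRing.scale /= set_freq_id; field; rewrite !gt_eqF.
Qed.

(** Own delay plus externalities is what the product rule gives for the total delay cost under
    [class_of S], that is, for [opt_cost]. *)
Lemma marginal_equationsP x : 0 < Psi S x -> 0 < Psi_H S x ->
  marginal_equations S x <-> forall k, g S k (x ord0 k) = opt_cost_grad k x.
Proof.
move=> Px Hx; have l0 := lambda_a_gt0 hS.
rewrite /marginal_equations.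
suff E k : cd S k * (if is_high (class_of S k) then D_H S x else D_L S x)
      + \sum_(j in calH) partial k (fun y => cdH S * D_H S y) x * x ord0 j
      + \sum_(j in calL) partial k (fun y => cdL S * D_L S y) x * x ord0 j
    = opt_cost_grad k x.
  by split=> e k; rewrite e E.
rewrite sum_calH sum_calL partial_D_H // partial_D_L // is_high_class_of cdE.
rewrite /opt_cost_grad /D_L /D_H.
by case: ifP => _ /=; field; rewrite !gt_eqF.
Qed.

(** Since [cdL S] and [cdH S] differ, exactly one of the two clauses applies to each user. *)
Lemma explicit_equationsP x : 0 < Psi S x -> 0 < Psi_H S x ->
  explicit_equations S x <-> forall k, g S k (x ord0 k) = opt_cost_grad k x.
Proof.
move=> Px Hx; have l0 := lambda_a_gt0 hS.
have EH k : k \in calH -> cd S k * D_H S x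
       + \sum_(j in calH) lambda_a S * cdH S * x ord0 j / Psi_H S x ^+ 2
       + \sum_(j in calL)
           lambda_a S * mu_B S * (Psi_H S x + Psi S x) * cdL S * x ord0 j
           / (Psi S x ^+ 2 * Psi_H S x ^+ 2) = opt_cost_grad k x.
  move=> kH; under eq_bigr do rewrite mulrAC.
  under [X in _ + _ + X]eq_bigr do rewrite mulrAC.
  rewrite sum_calH sum_calL cdE /opt_cost_grad kH /D_H /=.
  by field; rewrite !gt_eqF.
have EL k : k \notin calH -> cd S k * D_L S x
       + \sum_(j in calL)
           lambda_a S * mu_B S * cdL S * x ord0 j / (Psi S x ^+ 2 * Psi_H S x)
     = opt_cost_grad k x.
  move=> /negbTE kH; under eq_bigr do rewrite mulrAC.
  rewrite sum_calL cdE /opt_cost_grad kH /D_L /D_H /=.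
  by field; rewrite !gt_eqF.
have cdLH := lt_eqF (cdL_lt_cdH hS).
split=> e k.
- have [eH eL] := e k; have [kH|kH] := boolP (k \in calH).
    by rewrite -EH // -eH //; apply/eqP; rewrite cd_high.
  by rewrite -EL // -eL // cdE (negbTE kH) mul0r addr0.
- rewrite e; split=> c.
    by rewrite EH // -cd_high c.
  by rewrite EL // -cd_high c cdLH.
Qed.

(** * Sufficiency and necessity of the first-order conditions *)

Lemma marginal_optimum x : (forall k, 0 < x ord0 k < 1) -> 0 < Psi S x ->
  (forall k, g S k (x ord0 k) = opt_cost_grad k x) ->
  social_optimum S (class_of S) x.
Proof.
move=> xi Px gx.
have fx : feasible x by move=> k; have /andP[/ltW -> /ltW ->] := xi k.
split=> // i y fy.
have [Py|/social_profit_unstable -> //] := ltP 0 (Psi S y); last exact: leNye.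
have Hx := lt_le_trans Px (Psi_le_Psi_H _ fx).
have Hy := lt_le_trans Py (Psi_le_Psi_H _ fy).
rewrite [leRHS]social_profit_interior // delay_cost_class_of //.
(* Each utility is replaced by its tangent at [x], valid also where [y] has a frequency 0 or 1. *)
apply: (@le_trans _ _ (\sum_k (fine (U S k (x ord0 k))
    + g S k (x ord0 k) * (y ord0 k - x ord0 k)
    - cd S k * y ord0 k * sojourn i y (is_high (i k)))%:E)%E).
  apply: lee_sum => k _; rewrite V_stable // EFinB leeD2r //.
  exact: U_tangent _ _.
rewrite sumEFin lee_fin sumrB big_split /= -/(delay_cost i y) -addrA lerD2l.
(* The linear terms now match the tangent bound of [opt_cost], which in turn bounds the delay cost
   of [i] from below. *)
under eq_bigr do rewrite gx.
have := opt_cost_tangent _ _ Px Py Hx Hy; have := delay_cost_ge i _ fy Py.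
lra.
Qed.

Lemma optimum_marginal i x : (forall k, 0 < x ord0 k < 1) ->
  social_optimum S i x ->
  0 < Psi S x /\ forall k, g S k (x ord0 k) = opt_cost_grad k x.
Proof.
move=> xi [fx ox].
have Px : 0 < Psi S x.
  rewrite ltNge; apply/negP => /(social_profit_unstable i _ fx) e.
  have /(ox i) : feasible (0 : 'rV[R]_(NH + NL)).
    by move=> k; rewrite mxE lexx ler01.
  by rewrite e social_profit0.
split=> // k; have l0 := lambda_a_gt0 hS; have /andP[x0 x1] := xi k.
(* Below [b] the frequency is less than 1 and the added load [lambda_a S * (s - x ord0 k)] is less
   than the margin [Psi S x]. *)
set b := Num.min 1 (x ord0 k + Psi S x / lambda_a S).
have xb : x ord0 k \in `]0, b[.
  by rewrite in_itv /= x0 lt_min x1 ltrDl divr_gt0.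
have dom s : s \in `]0, b[ -> [/\ 0 < s < 1, 0 < Psi S (set_freq x k s),
    forall j, 0 < set_freq x k s ord0 j < 1 & feasible (set_freq x k s)].
  rewrite in_itv /= lt_min => /andP[s0 /andP[s1 sP]].
  have mi j : 0 < set_freq x k s ord0 j < 1.
    by rewrite set_freqE; case: eqP => // _; rewrite s0.
  split=> //; first by rewrite s0.
    by rewrite Psi_set_freq subr_gt0 mulrC -ltr_pdivlMr // ltrBlDl.
  by move=> j; have /andP[/ltW -> /ltW ->] := mi j.
(* Up to the utilities of the other users, this is the profit under [class_of S] along the frequency
   of user [k]. *)
pose F s := fine (U S k s) - opt_cost (set_freq x k s).
have DF s : s \in `]0, b[ ->
    is_derive s 1 F (g S k s - opt_cost_grad k (set_freq x k s)).
  move=> /dom[s01 Ps _ fs].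
  have DU : is_derive s 1 (fun s => fine (U S k s)) (g S k s).
    by have dU := U_derivable hS (k := k) s01; split => //; rewrite /g derive1E.
  have Hs := lt_le_trans Ps (Psi_le_Psi_H _ fs).
  have DO := is_derive_opt_cost x k s (lt0r_neq0 Ps) (lt0r_neq0 Hs).
  exact: is_deriveB.
have Fmax s : s \in `]0, b[ -> F s <= F (x ord0 k).
  move=> /dom[s01 Ps si fs].
  (* The competitor uses [class_of S]; at [x] itself [delay_cost_ge] bounds the cost under [i] below
     by [opt_cost x], so any optimal [i] will do. *)
  have := ox (class_of S) _ fs; rewrite !social_profit_interior // lee_fin.
  rewrite delay_cost_class_of // (bigD1 k) //=
    [in leRHS](bigD1 k) //= set_freqE eqxx.
  under eq_bigr => j /negbTE jk do rewrite set_freqE jk.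
  have := delay_cost_ge i _ fx Px.
  rewrite /F set_freq_id; lra.
have b0 : 0 <= b.
  by move: xb; rewrite in_itv /= => /andP[_ /ltW]; apply: le_trans; exact: ltW.
have := derive1_at_max b0 (fun s sb => @ex_derive _ _ _ _ _ _ _ (DF s sb)) xb Fmax.
move=> [_ F0]; have [_] := DF _ xb; rewrite F0 set_freq_id => /eqP.
by rewrite eq_sym subr_eq0 => /eqP.
Qed.

End Network.

Theorem theorem1 (R : realType) (d : measure_display)
    (Omega : measurableType d) (P : probability Omega R) (NH NL : nat)
    (S : mec R Omega NH NL) (hS : mec_assumptions P S)
    (x : 'rV[R]_(NH + NL)) (hx : forall k, 0 < x ord0 k < 1) :
  [/\ 0 < Psi S x -> marginal_equations S x -> social_optimum S (class_of S) x,
      (exists i, social_optimum S i x) -> 0 < Psi S x /\ marginal_equations S x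
    & 0 < Psi S x -> (marginal_equations S x <-> explicit_equations S x)].
Proof.
have fx : feasible x by move=> k; have /andP[/ltW -> /ltW ->] := hx k.
have Hx (Px : 0 < Psi S x) := lt_le_trans Px (Psi_le_Psi_H hS _ fx).
split.
- by move=> Px /(marginal_equationsP hS _ Px (Hx Px)); exact: (marginal_optimum hS).
- move=> [i /(optimum_marginal hS _ _ hx)[Px gx]]; split=> //.
  exact/(marginal_equationsP hS _ Px (Hx Px)).
- move=> Px; apply: (iff_trans (marginal_equationsP hS _ Px (Hx Px))).
  exact: iff_sym (explicit_equationsP hS _ Px (Hx Px)).
Qed.
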